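(* (In $\mathbf{ZF}+\mathbf{HB}$.) A sup-reflexive normed space does not contain any asymptotically isometric copy of $\ell^1(\mathbb N)$.
   Context: Normed spaces are real and not assumed complete. The base theory is Zermelo–Fraenkel set theory $\mathbf{ZF}$ without choice. $\mathbf{HB}$ is the Hahn–Banach axiom: given a real vector space $E$, a sublinear $p:E\to\mathbb R$, a vector subspace $F$ of $E$ and a linear $f:F\to\mathbb R$ with $f\le p$ on $F$, there is a linear $\tilde f:E\to\mathbb R$ extending $f$ with $\tilde f\le p$. For a normed space $E$, $\Gamma_E$ is its closed unit ball and $E'$ is its continuous dual. $E$ is sup-reflexive if every $f\in E'$ attains its supremum on $\Gamma_E$. $E$ contains an asymptotically isometric copy of $\ell^1(\mathbb N)$ if there exist a sequence $(a_n)_{n\in\mathbb N}$ of $\Gamma_E$ and a sequence $(\delta_n)_{n\in\mathbb N}$ of the open interval $]0,1[$ converging to $1$ such that for every finite sequence $(\lambda_i)_{0\le i\le n}$ of real numbers, $$\sum_{0\le i\le n}\delta_i|\lambda_i|\le\Big\|\sum_{0\le i\le n}\lambda_i a_i\Big\|.$$ *)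

(* Defs.v *)
From Stdlib Require Import Reals.
From Coquelicot Require Import Coquelicot.
Open Scope R_scope.

(* Real vector spaces are [ModuleSpace R_AbsRing] and real normed spaces are
   [NormedModule R_AbsRing]: completeness is not assumed, and, unlike in
   MathComp-Analysis, the carriers are not equipped with a choice operator. *)

Definition subspace (E : ModuleSpace R_AbsRing) (F : E -> Prop) : Prop :=
  F zero /\
  (forall x y : E, F x -> F y -> F (plus x y)) /\
  (forall (t : R) (x : E), F x -> F (scal t x)).

Definition linear_on (E : ModuleSpace R_AbsRing) (F : E -> Prop) (f : E -> R)
  : Prop :=
  (forall x y : E, F x -> F y -> f (plus x y) = f x + f y) /\
  (forall (t : R) (x : E), F x -> f (scal t x) = t * f x).

Definition linear_form (E : ModuleSpace R_AbsRing) (f : E -> R) : Prop :=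
  (forall x y : E, f (plus x y) = f x + f y) /\
  (forall (t : R) (x : E), f (scal t x) = t * f x).

Definition sublinear (E : ModuleSpace R_AbsRing) (p : E -> R) : Prop :=
  (forall x y : E, p (plus x y) <= p x + p y) /\
  (forall (t : R) (x : E), 0 <= t -> p (scal t x) = t * p x).

(* A linear form on the subspace [F] is represented by a function [f] on [E]
   whose values outside [F] are irrelevant. *)
Definition HB : Prop :=
  forall (E : ModuleSpace R_AbsRing) (p : E -> R) (F : E -> Prop) (f : E -> R),
    sublinear E p ->
    subspace E F ->
    linear_on E F f ->
    (forall x : E, F x -> f x <= p x) ->
    exists g : E -> R,
      linear_form E g /\
      (forall x : E, F x -> g x = f x) /\
      (forall x : E, g x <= p x).

Definition unit_ball (E : NormedModule R_AbsRing) (x : E) : Prop :=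
  norm x <= 1.

Definition continuous_dual (E : NormedModule R_AbsRing) (f : E -> R) : Prop :=
  linear_form E f /\ (forall x : E, continuous f x).

Definition sup_reflexive (E : NormedModule R_AbsRing) : Prop :=
  forall f : E -> R, continuous_dual E f ->
    exists x : E, unit_ball E x /\
      is_lub (fun r : R => exists y : E, unit_ball E y /\ r = f y) (f x).

(* [sum_f_R0 u n] and [sum_n u n] both sum the [n + 1] terms of index 0..n. *)
Definition contains_asymptotically_isometric_l1 (E : NormedModule R_AbsRing)
  : Prop :=
  exists (a : nat -> E) (delta : nat -> R),
    (forall n : nat, unit_ball E (a n)) /\
    (forall n : nat, 0 < delta n < 1) /\
    is_lim_seq delta 1 /\
    (forall (n : nat) (lambda : nat -> R),
       sum_f_R0 (fun i => delta i * Rabs (lambda i)) n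
       <= norm (sum_n (fun i => scal (lambda i) (a i)) n)).

(* Main.v *)
Require Import Defs.
From Stdlib Require Import Reals.
From Coquelicot Require Import Coquelicot.
From Stdlib Require Import Compare_dec Lra Lia FunctionalExtensionality ProofIrrelevance.

(** Let [(a n)], [(delta n)] witness an asymptotically isometric copy of l^1.
    The lower bound on the norm says that prescribing the value [c n] at [a n],
    with [Rabs (c n) <= delta n], defines a form of norm at most one on the span
    of the [a n]; Hahn-Banach extends it to the whole space.  Take in this way
    forms [g k] of norm at most one with [g k (a n) = delta n] for [k <= n] and
    [g k (a n) = - delta n] for [n < k] ([HB_interpolation]).  For fixed [n] the
    sequence [g k (a n)] is eventually [- delta n].  Extend the form
    [x |-> lim_k g k x], defined where the limit exists, to a form [h] of norm
    at most one ([HB_limit_form]); then [h (a n) = - delta n].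

    Consider [f = sum_k 2^(-k-2) (g k - h)], a form of norm at most one.  On
    [a n] its terms are nonnegative and those with [k <= n] add up to
    [delta n * (1 - 2^(-n-1))], which tends to 1.  So the supremum of [f] on the
    unit ball is 1; it is here that [delta] must tend to 1 and not merely stay
    away from 0.  If [f] attained it at [x], every term would be extremal:
    [g k x = 1] for all [k] and [h x = -1] ([averaged_difference_eq_one]).  But
    then [g k x] converges to 1, whence [h x = 1], a contradiction.

    The whole sequence [(g k)] comes from a single application of Hahn-Banach,
    on the space of absolutely summable sequences of vectors ([HB_sequence]),
    instead of one application and one choice for each [k].  Forms to be
    extended are given by their graphs throughout, so that their values need
    not be selected beforehand. *)

(** * Extending linear relations *)

(** Graph of a partial linear form, allowed a priori to be multivalued: domination
    by a sublinear functional forces it to be single-valued. *)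
Definition linear_relation (E : ModuleSpace R_AbsRing) (G : E -> R -> Prop)
  : Prop :=
  G zero 0 /\
  (forall x y r s, G x r -> G y s -> G (plus x y) (r + s)) /\
  (forall t x r, G x r -> G (scal t x) (t * r)).

Lemma sublinear_zero (E : ModuleSpace R_AbsRing) (p : E -> R) :
  sublinear E p -> p zero = 0.
Proof.
  intros [_ Hs].
  rewrite <- (scal_zero_l (zero : E)).
  change (p (scal 0 zero) = 0). rewrite Hs; lra.
Qed.

(** Two values [r], [s] at [x] put [r - s] among the values at [zero], where the
    dominating functional vanishes; exchanging them gives equality. *)
Lemma linear_relation_functional (E : ModuleSpace R_AbsRing) (p : E -> R)
  (G : E -> R -> Prop) :
  sublinear E p -> linear_relation E G -> (forall x r, G x r -> r <= p x) ->
  forall x r s, G x r -> G x s -> r = s.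
Proof.
  intros Hp (_ & Hplus & Hscal) Hle.
  assert (H : forall x r s, G x r -> G x s -> r <= s).
  { intros x r s Hr Hs.
    assert (Hx : p (plus x (scal (-1) x)) = 0).
    { rewrite (scal_opp_one x : scal (-1) x = opp x).
      rewrite <- (sublinear_zero _ _ Hp). f_equal.
      exact (plus_opp_r (G := ModuleSpace.AbelianGroup R_AbsRing E) x). }
    assert (H : r + -1 * s <= 0).
    { rewrite <- Hx. exact (Hle _ _ (Hplus _ _ _ _ Hr (Hscal (-1) _ _ Hs))). }
    lra. }
  intros x r s Hr Hs. apply Rle_antisym; eauto.
Qed.

(** The value of the partial form is recovered as the least upper bound of the set
    of its values, a singleton; this makes it a total function without
    appealing to a description operator. *)
Lemma HB_linear_relation (hHB : HB) (E : ModuleSpace R_AbsRing) (p : E -> R)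
  (G : E -> R -> Prop) :
  sublinear E p -> linear_relation E G -> (forall x r, G x r -> r <= p x) ->
  exists g, linear_form E g /\ (forall x r, G x r -> g x = r) /\
    (forall x, g x <= p x).
Proof.
  intros Hp HG Hle.
  pose (f := fun x => real (Lub_Rbar (G x))).
  assert (Hf : forall x r, G x r -> f x = r).
  { intros x r Hr. unfold f.
    rewrite (is_lub_Rbar_unique _ (Finite r)); [reflexivity|split].
    - intros s Hs. simpl.
      rewrite (linear_relation_functional E p G Hp HG Hle x s r Hs Hr). lra.
    - intros b Hb. exact (Hb r Hr). }
  assert (HG' := HG). destruct HG' as (H0 & Hplus & Hscal).
  destruct (hHB E p (fun x => exists r, G x r) f Hp) as (g & Hg & Hgf & Hgp).
  - repeat split.
    + exists 0. exact H0.
    + intros x y [r Hr] [s Hs]. eauto.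
    + intros t x [r Hr]. eauto.
  - split.
    + intros x y [r Hr] [s Hs].
      rewrite (Hf _ _ Hr), (Hf _ _ Hs). apply Hf. auto.
    + intros t x [r Hr]. rewrite (Hf _ _ Hr). apply Hf. auto.
  - intros x [r Hr]. rewrite (Hf _ _ Hr). auto.
  - exists g. repeat split; try apply Hg; auto.
    intros x r Hr. rewrite Hgf; [auto|eauto].
Qed.

(** * Linear forms of norm at most one *)

(** A linear form below the norm is below it in absolute value, so these are the
    elements of the dual unit ball. *)
Definition dominated_form (E : NormedModule R_AbsRing) (f : E -> R) : Prop :=
  linear_form E f /\ (forall x, f x <= norm x).

(** The axioms of a normed module only give [<=]; the converse is this inequality
    for the inverse scalar. *)
Lemma norm_scal_real (E : NormedModule R_AbsRing) (t : R) (x : E) :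
  norm (scal t x) = Rabs t * norm x.
Proof.
  apply Rle_antisym; [exact (norm_scal t x)|].
  destruct (Req_dec t 0) as [->|Ht].
  - rewrite Rabs_R0. generalize (norm_ge_0 (scal 0 x)). lra.
  - assert (H : norm x <= Rabs (/ t) * norm (scal t x)).
    { replace x with (scal (/ t) (scal t x)) at 1; [exact (norm_scal _ _)|].
      rewrite scal_assoc. change (mult (/ t) t) with (/ t * t).
      rewrite Rinv_l by exact Ht. exact (scal_one x). }
    apply Rmult_le_compat_l with (r := Rabs t) in H; [|apply Rabs_pos].
    rewrite <- Rmult_assoc, <- Rabs_mult, Rinv_r, Rabs_R1, Rmult_1_l in H
      by exact Ht.
    exact H.
Qed.

Lemma sublinear_norm (E : NormedModule R_AbsRing) :
  sublinear E (fun x => norm x).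
Proof.
  split.
  - intros x y. exact (norm_triangle x y).
  - intros t x Ht. rewrite norm_scal_real, Rabs_pos_eq; auto.
Qed.

Lemma dominated_form_Rabs_le (E : NormedModule R_AbsRing) (f : E -> R) (x : E) :
  dominated_form E f -> Rabs (f x) <= norm x.
Proof.
  intros [[_ Hs] Hle]. apply Rabs_le.
  assert (H := Hle (scal (-1) x)).
  rewrite Hs, norm_scal_real, (Rabs_left (-1)) in H by lra.
  generalize (Hle x). lra.
Qed.

Lemma dominated_form_continuous_dual (E : NormedModule R_AbsRing) (f : E -> R) :
  dominated_form E f -> continuous_dual E f.
Proof.
  intros Hf. split; [apply Hf|].
  intros x. apply (linear_cont (K := R_AbsRing) (V := R_NormedModule)).
  constructor.
  - apply Hf.
  - apply Hf.
  - exists 1. split; [lra|].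
    intros y. rewrite Rmult_1_l. exact (dominated_form_Rabs_le E f y Hf).
Qed.

Lemma linear_relation_lim (E : ModuleSpace R_AbsRing) (g : nat -> E -> R) :
  (forall k, linear_form E (g k)) ->
  linear_relation E (fun x r => is_lim_seq (fun k => g k x) r).
Proof.
  intros Hg. split; [|split].
  - apply is_lim_seq_ext with (fun _ => 0); [|apply is_lim_seq_const].
    intros k. rewrite <- (scal_zero_l (zero : E)).
    change (0 = g k (scal 0 zero)).
    rewrite (proj2 (Hg k)). lra.
  - intros x y r s Hr Hs.
    apply is_lim_seq_ext with (fun k => g k x + g k y).
    + intros k. symmetry. apply Hg.
    + apply is_lim_seq_plus'; auto.
  - intros t x r Hr.
    apply is_lim_seq_ext with (fun k => t * g k x).
    + intros k. symmetry. apply Hg.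
    + exact (is_lim_seq_scal_l _ t r Hr).
Qed.

(** A substitute for a limit along an ultrafilter: convergence of [g k x] is a linear
    condition on [x], and the limit inherits the bound by the norm. *)
Lemma HB_limit_form (hHB : HB) (E : NormedModule R_AbsRing) (g : nat -> E -> R) :
  (forall k, dominated_form E (g k)) ->
  exists h, dominated_form E h /\
    forall x r, is_lim_seq (fun k => g k x) (Finite r) -> h x = r.
Proof.
  intros Hg.
  destruct (HB_linear_relation hHB E (fun x => norm x)
    (fun x r => is_lim_seq (fun k => g k x) r)) as (h & Hh & Hlim & Hle).
  - apply sublinear_norm.
  - apply linear_relation_lim. intros k. apply Hg.
  - intros x r Hr.
    apply (is_lim_seq_le (fun k => g k x) (fun _ => norm x) r (norm x)); auto.
    + intros k. apply Hg.
    + apply is_lim_seq_const.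
  - exists h. repeat split; try apply Hh; auto.
Qed.

(** * Summable sequences in a normed space *)

(** The space l^1(E).  A bounded form on it is the same thing as a bounded sequence of
    forms on [E], which turns a sequence of extension problems into one. *)
Definition summable_seq (E : NormedModule R_AbsRing) : Type :=
  {x : nat -> E | ex_series (fun n => norm (x n))}.

Section SummableSequences.

Context {E : NormedModule R_AbsRing}.

Lemma summable_seq_ext (x y : summable_seq E) :
  (forall n, proj1_sig x n = proj1_sig y n) -> x = y.
Proof.
  intros H. apply eq_sig_hprop.
  - intros. apply proof_irrelevance.
  - apply functional_extensionality. exact H.
Qed.

Lemma summable_le (u : nat -> E) (v : nat -> R) :
  (forall n, norm (u n) <= v n) -> ex_series v ->
  ex_series (fun n => norm (u n)).
Proof.
  intros H Hv.
  apply (ex_series_le (K := R_AbsRing) (V := R_CompleteNormedModule) _ v).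
  - intros n. change (Rabs (norm (u n)) <= v n).
    rewrite Rabs_pos_eq; [apply H|apply norm_ge_0].
  - exact Hv.
Qed.

Lemma summable_zero : ex_series (fun n : nat => norm (zero : E)).
Proof.
  exists 0. apply is_series_ext with (fun _ => 0).
  - intros _. symmetry. exact norm_zero.
  - apply (is_lim_seq_ext (fun _ => 0) _ 0); [|apply is_lim_seq_const].
    intros n. rewrite sum_n_const. ring.
Qed.

Lemma summable_plus (x y : nat -> E) :
  ex_series (fun n => norm (x n)) -> ex_series (fun n => norm (y n)) ->
  ex_series (fun n => norm (plus (x n) (y n))).
Proof.
  intros Hx Hy. apply summable_le with (fun n => norm (x n) + norm (y n)).
  - intros n. exact (norm_triangle _ _).
  - exact (ex_series_plus _ _ Hx Hy).
Qed.

Lemma summable_scal (t : R) (x : nat -> E) :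
  ex_series (fun n => norm (x n)) ->
  ex_series (fun n => norm (scal t (x n))).
Proof.
  intros Hx. apply summable_le with (fun n => Rabs t * norm (x n)).
  - intros n. exact (norm_scal _ _).
  - exact (ex_series_scal (V := R_NormedModule) (Rabs t) _ Hx).
Qed.

Lemma summable_opp (x : nat -> E) :
  ex_series (fun n => norm (x n)) -> ex_series (fun n => norm (opp (x n))).
Proof.
  intros Hx. apply summable_le with (2 := Hx).
  intros n. rewrite norm_opp. lra.
Qed.

Definition summable_seq_zero : summable_seq E :=
  exist _ (fun _ => zero) summable_zero.

Definition summable_seq_plus (x y : summable_seq E) : summable_seq E :=
  exist _ (fun n => plus (proj1_sig x n) (proj1_sig y n))
    (summable_plus _ _ (proj2_sig x) (proj2_sig y)).

Definition summable_seq_opp (x : summable_seq E) : summable_seq E :=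
  exist _ (fun n => opp (proj1_sig x n)) (summable_opp _ (proj2_sig x)).

Definition summable_seq_scal (t : R) (x : summable_seq E) : summable_seq E :=
  exist _ (fun n => scal t (proj1_sig x n)) (summable_scal t _ (proj2_sig x)).

Definition summable_seq_AbelianMonoid : AbelianMonoid.
Proof.
  refine (AbelianMonoid.Pack (summable_seq E)
    (AbelianMonoid.Mixin _ summable_seq_plus summable_seq_zero _ _ _)
    (summable_seq E));
  intros; apply summable_seq_ext; intros n; simpl.
  - apply plus_comm.
  - apply plus_assoc.
  - apply plus_zero_r.
Defined.

Definition summable_seq_AbelianGroup : AbelianGroup.
Proof.
  refine (AbelianGroup.Pack (summable_seq E)
    (AbelianGroup.Class _ _
      (AbelianGroup.Mixin summable_seq_AbelianMonoid summable_seq_opp _))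
    (summable_seq E)).
  intros; apply summable_seq_ext; intros n; simpl.
  apply (plus_opp_r (G := NormedModule.AbelianGroup R_AbsRing E)).
Defined.

Definition summable_seq_ModuleSpace : ModuleSpace R_AbsRing.
Proof.
  refine (ModuleSpace.Pack R_AbsRing (summable_seq E)
    (ModuleSpace.Class _ _ _
      (ModuleSpace.Mixin R_AbsRing summable_seq_AbelianGroup
        summable_seq_scal _ _ _ _))
    (summable_seq E));
  intros; apply summable_seq_ext; intros n; simpl.
  - apply scal_assoc.
  - apply (scal_one (K := R_AbsRing)
      (V := NormedModule.ModuleSpace R_AbsRing E)).
  - apply (scal_distr_l (K := R_AbsRing)
      (V := NormedModule.ModuleSpace R_AbsRing E)).
  - apply (scal_distr_r (K := R_AbsRing)
      (V := NormedModule.ModuleSpace R_AbsRing E)).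
Defined.

Definition sum_norm (x : summable_seq_ModuleSpace) : R :=
  Series (fun n => norm (proj1_sig x n)).

Lemma sublinear_sum_norm : sublinear summable_seq_ModuleSpace sum_norm.
Proof.
  split.
  - intros x y. unfold sum_norm.
    rewrite <- Series_plus by apply proj2_sig.
    apply Series_le.
    + intros n. split; [apply norm_ge_0|exact (norm_triangle _ _)].
    + exact (ex_series_plus _ _ (proj2_sig x) (proj2_sig y)).
  - intros t x Ht. unfold sum_norm.
    rewrite <- Series_scal_l. apply Series_ext. intros n.
    change (norm (scal t (proj1_sig x n)) = t * norm (proj1_sig x n)).
    rewrite norm_scal_real, Rabs_pos_eq; auto.
Qed.

Definition single (k : nat) (x : E) (n : nat) : E :=
  if Nat.eq_dec n k then x else zero.

Lemma is_series_single (k : nat) (u : nat -> R) (r : R) :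
  u k = r -> (forall n, n <> k -> u n = 0) -> is_series u r.
Proof.
  intros <- Hu.
  apply (is_lim_seq_ext_loc (fun _ => u k) _ (u k));
    [|apply is_lim_seq_const].
  assert (H : forall n, sum_f_R0 u n = if le_dec k n then u k else 0).
  { induction n as [|n IH]; simpl.
    - destruct (le_dec k 0).
      + f_equal. lia.
      + apply Hu. lia.
    - rewrite IH.
      destruct (le_dec k n), (le_dec k (S n)); try lia.
      + rewrite (Hu (S n)) by lia. ring.
      + replace (S n) with k by lia. ring.
      + rewrite (Hu (S n)) by lia. ring. }
  exists k. intros n Hn. rewrite sum_n_Reals, H.
  destruct (le_dec k n); [reflexivity|lia].
Qed.

Lemma is_series_norm_single (k : nat) (x : E) :
  is_series (fun n => norm (single k x n)) (norm x).
Proof.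
  apply (is_series_single k).
  - unfold single. destruct (Nat.eq_dec k k); easy.
  - intros n Hn. unfold single. destruct (Nat.eq_dec n k); [easy|].
    exact norm_zero.
Qed.

Definition summable_single (k : nat) (x : E) : summable_seq_ModuleSpace :=
  exist _ (single k x) (ex_intro _ _ (is_series_norm_single k x)).

Lemma linear_form_summable_single (k : nat)
  (Phi : summable_seq_ModuleSpace -> R) :
  linear_form _ Phi -> linear_form E (fun x => Phi (summable_single k x)).
Proof.
  intros [Hplus Hscal]. split.
  - intros x y. rewrite <- Hplus. f_equal.
    apply summable_seq_ext. intros n. simpl. unfold single.
    destruct (Nat.eq_dec n k); [reflexivity|].
    symmetry. apply plus_zero_r.
  - intros t x. rewrite <- Hscal. f_equal.
    apply summable_seq_ext. intros n. simpl. unfold single.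
    destruct (Nat.eq_dec n k); [reflexivity|].
    symmetry. exact (scal_zero_r t).
Qed.

(** The partial forms [G k] add up to the partial form [x |-> sum_k (G k) (x k)] on
    l^1(E), dominated by the sum of the norms.  The form [g k] is the restriction
    of one extension of it to the sequences concentrated at the index [k]. *)
Lemma HB_sequence (hHB : HB) (G : nat -> E -> R -> Prop) :
  (forall k, linear_relation E (G k)) ->
  (forall k x r, G k x r -> r <= norm x) ->
  exists g : nat -> E -> R, forall k, dominated_form E (g k) /\
    (forall x r, G k x r -> g k x = r).
Proof.
  intros HG Hle.
  destruct (HB_linear_relation hHB summable_seq_ModuleSpace sum_norm
    (fun x r => exists rho, (forall k, G k (proj1_sig x k) (rho k)) /\
                  is_series rho r)) as (Phi & HPhi & HPhiG & HPhile).
  - apply sublinear_sum_norm.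
  - split; [|split].
    + exists (fun _ => 0). split; [intros k; apply (HG k)|].
      now apply (is_series_single 0).
    + intros x y r s (rho & Hx & Hr) (sigma & Hy & Hs).
      exists (fun k => rho k + sigma k). split.
      * intros k. apply (HG k); auto.
      * exact (is_series_plus _ _ _ _ Hr Hs).
    + intros t x r (rho & Hx & Hr).
      exists (fun k => t * rho k). split.
      * intros k. apply (HG k); auto.
      * exact (is_series_scal (V := R_NormedModule) t _ _ Hr).
  - intros x r (rho & Hx & Hr).
    apply (is_lim_seq_le (sum_n rho) (sum_n (fun n => norm (proj1_sig x n)))
      r (sum_norm x)).
    + intros n. rewrite !sum_n_Reals. apply sum_Rle. eauto.
    + exact Hr.
    + exact (Series_correct _ (proj2_sig x)).
  - exists (fun k x => Phi (summable_single k x)). intros k.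
    split; [split|].
    + apply linear_form_summable_single, HPhi.
    + intros x. rewrite <- (is_series_unique _ _ (is_series_norm_single k x)).
      exact (HPhile (summable_single k x)).
    + intros x r Hr. apply HPhiG.
      exists (fun n => if Nat.eq_dec n k then r else 0). split.
      * intros n. simpl. unfold single.
        destruct (Nat.eq_dec n k) as [->|_]; [exact Hr|apply (HG n)].
      * apply (is_series_single k).
        -- destruct (Nat.eq_dec k k); easy.
        -- intros n Hn. destruct (Nat.eq_dec n k); easy.
Qed.

End SummableSequences.

(** * Interpolation on an almost isometric copy of the summable sequences *)

(** Graph of the form on the span of [a] sending [a i] to [c i].  Asking that the
    partial sums be eventually constant encodes finite linear combinations without
    fixing their length, so two of them are added termwise. *)
Definition combination_values (E : NormedModule R_AbsRing) (a : nat -> E)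
  (c : nat -> R) (x : E) (r : R) : Prop :=
  exists lambda : nat -> R, eventually (fun n =>
    sum_n (fun i => scal (lambda i) (a i)) n = x /\
    sum_n (fun i => lambda i * c i) n = r).

Lemma linear_relation_combination_values (E : NormedModule R_AbsRing)
  (a : nat -> E) (c : nat -> R) :
  linear_relation E (combination_values E a c).
Proof.
  split; [|split].
  - exists (fun _ => 0). exists 0%nat. intros n _. split.
    + rewrite (sum_n_ext _ (fun i => scal (zero : R_AbsRing) (a i)))
        by reflexivity.
      rewrite (sum_n_scal_l (K := R_AbsRing)). apply (scal_zero_l (K := R_AbsRing)).
    + rewrite (sum_n_ext _ (fun _ => 0)) by (intros; apply Rmult_0_l).
      rewrite sum_n_const. apply Rmult_0_r.
  - intros x y r s (l & N & Hl) (m & M & Hm).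
    exists (fun i => l i + m i). exists (N + M)%nat. intros n Hn.
    destruct (Hl n) as [<- <-]; [lia|].
    destruct (Hm n) as [<- <-]; [lia|].
    change Rplus with (plus (G := R_AbelianMonoid)).
    rewrite <- !sum_n_plus. split; apply sum_n_ext; intros i.
    + exact (scal_distr_r (l i) (m i) (a i)).
    + exact (Rmult_plus_distr_r (l i) (m i) (c i)).
  - intros t x r (l & N & Hl).
    exists (fun i => t * l i). exists N. intros n Hn.
    destruct (Hl n Hn) as [<- <-]. split.
    + etransitivity;
        [|exact (sum_n_scal_l (K := R_AbsRing)
            (V := NormedModule.ModuleSpace R_AbsRing E) t _ n)].
      apply sum_n_ext. intros i. symmetry. exact (scal_assoc t (l i) (a i)).
    + etransitivity;
        [|exact (sum_n_scal_l (K := R_AbsRing) (V := R_ModuleSpace) t _ n)].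
      apply sum_n_ext. intros i. exact (Rmult_assoc t (l i) (c i)).
Qed.

Lemma combination_values_generator (E : NormedModule R_AbsRing) (a : nat -> E)
  (c : nat -> R) (k : nat) : combination_values E a c (a k) (c k).
Proof.
  assert (H : forall (V : ModuleSpace R_AbsRing) (v : nat -> V) (n : nat),
    sum_n (fun i => scal (if Nat.eq_dec i k then 1 else 0) (v i)) n =
    if le_dec k n then v k else zero).
  { intros V v.
    assert (H1 : forall y : V, scal 1 y = y)
      by (intros y; exact (scal_one y)).
    assert (H0 : forall y : V, scal 0 y = zero)
      by (intros y; exact (scal_zero_l y)).
    induction n as [|n IH].
    - rewrite sum_O. destruct (Nat.eq_dec 0 k), (le_dec k 0); try lia.
      + subst. apply H1.
      + apply H0.
    - rewrite sum_Sn, IH.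
      destruct (Nat.eq_dec (S n) k), (le_dec k n), (le_dec k (S n)); try lia.
      + subst. rewrite H1. apply plus_zero_l.
      + rewrite H0. apply plus_zero_r.
      + rewrite H0. apply plus_zero_r. }
  exists (fun i => if Nat.eq_dec i k then 1 else 0). exists k. intros n Hn.
  split.
  - rewrite H. destruct (le_dec k n); [reflexivity|lia].
  - assert (Hc := H R_ModuleSpace c n).
    destruct (le_dec k n); [exact Hc|lia].
Qed.

(** The defining inequality of the copy of l^1 bounds
    [sum (c i * lambda i)] by [sum (delta i * Rabs (lambda i))] and hence by the
    norm of the combination. *)
Lemma combination_values_le_norm (E : NormedModule R_AbsRing) (a : nat -> E)
  (delta c : nat -> R) :
  (forall (n : nat) (lambda : nat -> R),
     sum_f_R0 (fun i => delta i * Rabs (lambda i)) n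
     <= norm (sum_n (fun i => scal (lambda i) (a i)) n)) ->
  (forall i, Rabs (c i) <= delta i) ->
  forall x r, combination_values E a c x r -> r <= norm x.
Proof.
  intros Ha Hc x r (l & N & Hl).
  destruct (Hl N) as [<- <-]; [lia|].
  eapply Rle_trans; [|apply Ha].
  rewrite sum_n_Reals. apply sum_Rle. intros i _.
  eapply Rle_trans; [apply Rle_abs|].
  rewrite Rabs_mult, Rmult_comm.
  apply Rmult_le_compat_r; [apply Rabs_pos|apply Hc].
Qed.

Lemma HB_interpolation (hHB : HB) (E : NormedModule R_AbsRing) (a : nat -> E)
  (delta : nat -> R) (c : nat -> nat -> R) :
  (forall (n : nat) (lambda : nat -> R),
     sum_f_R0 (fun i => delta i * Rabs (lambda i)) n
     <= norm (sum_n (fun i => scal (lambda i) (a i)) n)) ->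
  (forall k i, Rabs (c k i) <= delta i) ->
  exists g : nat -> E -> R,
    (forall k, dominated_form E (g k)) /\ (forall k n, g k (a n) = c k n).
Proof.
  intros Ha Hc.
  destruct (HB_sequence hHB (fun k => combination_values E a (c k)))
    as [g Hg].
  - intros k. apply linear_relation_combination_values.
  - intros k. exact (combination_values_le_norm E a delta (c k) Ha (Hc k)).
  - exists g. split; intros k; [apply Hg|].
    intros n. apply Hg, combination_values_generator.
Qed.

(** * A form that does not attain its norm *)

Lemma sum_n_le_series (u : nat -> R) (l : R) (n : nat) :
  (forall k, 0 <= u k) -> is_series u l -> sum_n u n <= l.
Proof.
  intros Hu Hl. apply (is_lim_seq_incr_compare (sum_n u) l Hl).
  intros m. rewrite sum_Sn. change plus with Rplus. generalize (Hu (S m)). lra.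
Qed.

Lemma series_nonneg_eq_zero (u : nat -> R) (l : R) (n : nat) :
  (forall k, 0 <= u k) -> is_series u l -> l <= 0 -> u n = 0.
Proof.
  intros Hu Hl Hl0. apply Rle_antisym; [|apply Hu].
  apply Rle_trans with (sum_n u n).
  - destruct n as [|n]; [rewrite sum_O; lra|].
    rewrite sum_Sn. change plus with Rplus.
    enough (0 <= sum_n u n) by lra.
    rewrite sum_n_Reals. apply cond_pos_sum. exact Hu.
  - apply Rle_trans with l; [|exact Hl0]. apply sum_n_le_series; auto.
Qed.

(** Normalized so that the total is 1/2, since a difference of two forms of norm at
    most one has norm at most two. *)
Definition weight (k : nat) : R := / 4 * (/ 2) ^ k.

Lemma weight_pos (k : nat) : 0 < weight k.
Proof. unfold weight. apply Rmult_lt_0_compat; [|apply pow_lt]; lra. Qed.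

Lemma is_series_weight : is_series weight (/ 2).
Proof.
  replace (/ 2) with (/ 4 * / (1 - / 2)) by field.
  apply (is_series_scal (V := R_NormedModule) (/ 4) (fun k => (/ 2) ^ k)).
  apply is_series_geom. rewrite Rabs_pos_eq; lra.
Qed.

Lemma is_series_weight_mul (c : R) : is_series (fun k => c * weight k) (c / 2).
Proof. exact (is_series_scal (V := R_NormedModule) c _ _ is_series_weight). Qed.

Definition averaged_difference {E : NormedModule R_AbsRing}
  (g : nat -> E -> R) (h : E -> R) (x : E) : R :=
  Series (fun k => weight k * (g k x - h x)).

Section AveragedDifference.

Context {E : NormedModule R_AbsRing} (g : nat -> E -> R) (h : E -> R)
  (Hg : forall k, dominated_form E (g k)) (Hh : dominated_form E h).

Lemma difference_bound (k : nat) (x : E) : Rabs (g k x - h x) <= 2 * norm x.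
Proof.
  generalize (dominated_form_Rabs_le E (g k) x (Hg k))
    (dominated_form_Rabs_le E h x Hh) (Rabs_triang (g k x) (- h x)).
  rewrite Rabs_Ropp. unfold Rminus. lra.
Qed.

Lemma is_series_averaged_difference (x : E) :
  is_series (fun k => weight k * (g k x - h x)) (averaged_difference g h x).
Proof.
  apply Series_correct.
  apply (ex_series_le (K := R_AbsRing) (V := R_CompleteNormedModule)
    _ (fun k => (2 * norm x) * weight k)).
  - intros k. change (Rabs (weight k * (g k x - h x)) <= 2 * norm x * weight k).
    rewrite Rabs_mult, Rmult_comm, (Rabs_pos_eq (weight k))
      by apply Rlt_le, weight_pos.
    apply Rmult_le_compat_r; [apply Rlt_le, weight_pos|apply difference_bound].
  - eexists. apply is_series_weight_mul.
Qed.

Lemma averaged_difference_dominated :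
  dominated_form E (averaged_difference g h).
Proof.
  split; [split|].
  - intros x y. apply is_series_unique.
    eapply is_series_ext;
      [|exact (is_series_plus _ _ _ _ (is_series_averaged_difference x)
          (is_series_averaged_difference y))].
    intros k. change (weight k * (g k x - h x) + weight k * (g k y - h y) =
      weight k * (g k (plus x y) - h (plus x y))).
    rewrite (proj1 (proj1 (Hg k))), (proj1 (proj1 Hh)). ring.
  - intros t x. apply is_series_unique.
    eapply is_series_ext;
      [|exact (is_series_scal (V := R_NormedModule) t _ _
          (is_series_averaged_difference x))].
    intros k. change (t * (weight k * (g k x - h x)) =
      weight k * (g k (scal t x) - h (scal t x))).
    rewrite (proj2 (proj1 (Hg k))), (proj2 (proj1 Hh)). ring.
  - intros x.
    apply (is_lim_seq_le (sum_n (fun k => weight k * (g k x - h x)))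
      (sum_n (fun k => (2 * norm x) * weight k))
      (averaged_difference g h x) (norm x)).
    + intros n. rewrite !sum_n_Reals. apply sum_Rle. intros k _.
      rewrite Rmult_comm.
      apply Rmult_le_compat_r; [apply Rlt_le, weight_pos|].
      eapply Rle_trans; [apply Rle_abs|apply difference_bound].
    + exact (is_series_averaged_difference x).
    + assert (H := is_series_weight_mul (2 * norm x)).
      replace (2 * norm x / 2) with (norm x) in H by field. exact H.
Qed.

(** The terms [weight k * (2 - (g k x - h x))] are nonnegative with sum at most 0, so
    each vanishes; [g k x - h x = 2] with both values in [-1, 1] leaves only one
    possibility. *)
Lemma averaged_difference_eq_one (x : E) :
  norm x <= 1 -> 1 <= averaged_difference g h x ->
  h x = -1 /\ forall k, g k x = 1.
Proof.
  intros Hx H1.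
  assert (Hd : forall k, g k x - h x <= 2).
  { intros k. generalize (Rle_abs (g k x - h x)) (difference_bound k x). lra. }
  assert (H2 : forall k, g k x - h x = 2).
  { intros k.
    assert (H : weight k * (2 - (g k x - h x)) = 0).
    { apply (series_nonneg_eq_zero (fun k => weight k * (2 - (g k x - h x)))
        (2 / 2 - averaged_difference g h x)).
      - intros j. apply Rmult_le_pos; [apply Rlt_le, weight_pos|].
        generalize (Hd j). lra.
      - eapply is_series_ext;
          [|exact (is_series_minus _ _ _ _ (is_series_weight_mul 2)
              (is_series_averaged_difference x))].
        intros j. change (2 * weight j - weight j * (g j x - h x) =
          weight j * (2 - (g j x - h x))). ring.
      - lra. }
    apply Rmult_integral in H. generalize (weight_pos k).
    destruct H; lra. }
  assert (Hb := dominated_form_Rabs_le E h x Hh). apply Rabs_le_between in Hb.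
  assert (Hgk : forall k, g k x <= 1)
    by (intros k; generalize (proj2 (Hg k) x); lra).
  split.
  - generalize (H2 0%nat) (Hgk 0%nat). lra.
  - intros k. generalize (H2 k) (Hgk k). lra.
Qed.

(** Meant for [x = a n], where the dropped terms vanish, so that nothing is lost. *)
Lemma averaged_difference_ge_partial (x : E) (d : R) (n : nat) :
  (forall k, h x <= g k x) ->
  (forall k, (k <= n)%nat -> g k x - h x = 2 * d) ->
  2 * d * sum_n weight n <= averaged_difference g h x.
Proof.
  intros Hpos Heq.
  apply Rle_trans with (sum_n (fun k => weight k * (g k x - h x)) n).
  - apply Req_le. rewrite !sum_n_Reals, scal_sum.
    apply PartSum.sum_eq. intros k Hk. rewrite Heq by exact Hk. ring.
  - apply sum_n_le_series; [|apply is_series_averaged_difference].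
    intros k. apply Rmult_le_pos; [apply Rlt_le, weight_pos|].
    generalize (Hpos k). lra.
Qed.

End AveragedDifference.

Theorem theorem3 (hHB : HB) (E : NormedModule R_AbsRing)
  (hE : sup_reflexive E) : ~ contains_asymptotically_isometric_l1 E.
Proof.
  intros (a & delta & Ha & Hdelta & Hlim & Hl1).
  destruct (HB_interpolation hHB E a delta
    (fun k n => if le_dec k n then delta n else - delta n) Hl1)
    as (g & Hg & Hga).
  { intros k i. specialize (Hdelta i). apply Rabs_le.
    destruct (le_dec k i); lra. }
  destruct (HB_limit_form hHB E g Hg) as (h & Hh & Hhlim).
  assert (Hha : forall n, h (a n) = - delta n).
  { intros n. apply Hhlim.
    apply is_lim_seq_ext_loc with (fun _ => - delta n);
      [|apply is_lim_seq_const].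
    exists (S n). intros k Hk. rewrite Hga.
    destruct (le_dec k n); [lia|reflexivity]. }
  destruct (hE (averaged_difference g h)) as (x & Hx & Hmax & _).
  { apply dominated_form_continuous_dual, averaged_difference_dominated; auto. }
  assert (H1 : 1 <= averaged_difference g h x).
  { apply (is_lim_seq_le (fun n => 2 * delta n * sum_n weight n)
      (fun _ => averaged_difference g h x) 1 (averaged_difference g h x)).
    - intros n. apply Rle_trans with (averaged_difference g h (a n)).
      + apply averaged_difference_ge_partial; auto; intros k;
          rewrite Hha, Hga; specialize (Hdelta n);
          destruct (le_dec k n); intros; lra || lia.
      + apply Hmax. exists (a n). auto.
    - replace 1 with (2 * 1 * / 2) by field.
      apply is_lim_seq_mult'; [|exact is_series_weight].
      apply (is_lim_seq_scal_l delta 2 1 Hlim).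
    - apply is_lim_seq_const. }
  destruct (averaged_difference_eq_one g h Hg Hh x Hx H1) as [Hhx Hgx].
  (* All [g k x] equal 1, so [h] takes at [x] their limit. *)
  assert (H : h x = 1).
  { apply Hhlim. apply is_lim_seq_ext with (fun _ => 1);
      [|apply is_lim_seq_const].
    intros k. symmetry. apply Hgx. }
  lra.
Qed.
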